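(* Let $\rho\in E$. Then there exists a constant $c$ that depends only on $\rho$ such that for any finite set $\mathcal{A}\subseteq E$, \[ \omega_E\Big(\prod_{\substack{a,b\in\mathcal{A}\\ a\ne b}}(a+\rho b)\Big) > \frac{\log|\mathcal{A}|}{\log 3}-c. \]
   Context: Let $\omega=\frac{-1+i\sqrt3}{2}$ and let $E=\{a+b\omega: a,b\in\mathbb{Z}\}\subset\mathbb{C}$ be the ring of Eulerian (i.e. Eisenstein) integers. An Euler prime is a prime element of $E$. For $x\in E$, $\omega_E(x)$ denotes the number of distinct Euler prime divisors of $x$, where two primes are considered distinct if they are not associates in $E$.
   Formalization: The formal statement assumes ρ ≠ 0: for ρ = 0 the claim is false, since for A = {1, 2, 4, …, 2^n} the product is a power of the Euler prime 2, so ω_E = 1 while log|A| is unbounded. *)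

(* Defs.v *)
From HB Require Import structures.
From mathcomp Require Import all_boot all_order all_algebra finmap.
From mathcomp Require Import complex ring.
From mathcomp Require Import all_classical reals constructive_ereal.
From mathcomp Require Import counting_measure exp.

Set Implicit Arguments.
Unset Strict Implicit.
Unset Printing Implicit Defensive.

Import Order.TTheory GRing.Theory Num.Theory.

Local Open Scope ring_scope.

Section Divisibility.
Variable D : idomainType.
Implicit Types p q x y : D.

Definition divides x y : Prop := exists z, y = z * x.

Definition prime_elt p : Prop :=
  [/\ p != 0, p \isn't a GRing.unit &
      forall x y, divides p (x * y) -> divides p x \/ divides p y].

Definition associates p q : Prop := exists2 u, u \is a GRing.unit & q = u * p.

End Divisibility.

Section Eisenstein.
Variable R : realType.
Local Open Scope complex_scope.

Definition omega : R[i] := (- 1 + 'i * (Num.sqrt 3)%:C) / 2.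

Definition eisenstein_pred : {pred R[i]} :=
  fun z => `[< exists a b : int, z = a%:~R + b%:~R * omega >].

Lemma omega_sqr : omega * omega = - 1 - omega.
Proof.
have h3 : (Num.sqrt 3 : R) ^+ 2 = 3 by rewrite sqr_sqrtr.
have hs : ('i * (Num.sqrt 3)%:C : R[i]) ^+ 2 = - 3.
  by rewrite exprMn sqr_i -rmorphXn /= h3 mulN1r rmorph_nat.
rewrite /omega; set s := 'i * _ in hs *.
have -> : (- 1 + s) / 2 * ((- 1 + s) / 2) = (1 - 2 * s + s ^+ 2) / 4 by field.
by rewrite hs; field.
Qed.

Lemma eisenstein_subring_closed : subring_closed eisenstein_pred.
Proof.
split.
- by apply/asboolP; exists 1, 0; rewrite mul0r addr0.
- move=> x y /asboolP[a [b ->]] /asboolP[c [d ->]]; apply/asboolP.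
  by exists (a - c), (b - d); rewrite !rmorphB /= mulrBl opprD addrACA.
- move=> x y /asboolP[a [b ->]] /asboolP[c [d ->]]; apply/asboolP.
  exists (a * c - b * d), (a * d + b * c - b * d).
  rewrite !(rmorphB, rmorphD, rmorphM) /=.
  rewrite !mulrDl !mulrDr mulrACA omega_sqr; ring.
Qed.

HB.instance Definition _ :=
  GRing.isSubringClosed.Build R[i] eisenstein_pred eisenstein_subring_closed.

Record eisenstein := Eisenstein {
  eisenstein_val :> R[i];
  eisenstein_valP : eisenstein_val \in eisenstein_pred }.

HB.instance Definition _ := [isSub for eisenstein_val].
HB.instance Definition _ := [Choice of eisenstein by <:].
HB.instance Definition _ := [SubChoice_isSubComNzRing of eisenstein by <:].

Definition eisenstein_unit : {pred eisenstein} :=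
  fun x => (val x != 0) && ((val x)^-1 \in eisenstein_pred).

Definition eisenstein_inv (x : eisenstein) : eisenstein := insubd x (val x)^-1.

Lemma eisenstein_mulVx :
  {in eisenstein_unit, left_inverse 1 eisenstein_inv *%R}.
Proof.
move=> x /andP[x0 xV]; apply: val_inj.
by rewrite rmorphM rmorph1 /= /eisenstein_inv insubdK // mulVf.
Qed.

Lemma eisenstein_unitPl (x y : eisenstein) : y * x = 1 -> eisenstein_unit x.
Proof.
move=> yx1; have yx : val y * val x = 1 by rewrite -rmorphM yx1 rmorph1.
have x0 : val x != 0.
  by apply/eqP => x0; move/eqP: yx; rewrite x0 mulr0 eq_sym oner_eq0.
rewrite /eisenstein_unit x0 /=.
suff -> : (val x)^-1 = val y by apply: valP.
by apply: (mulIf x0); rewrite mulVf.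
Qed.

Lemma eisenstein_invr_out :
  {in [predC eisenstein_unit], eisenstein_inv =1 id}.
Proof.
move=> x; rewrite !inE /eisenstein_unit negb_and negbK => /orP[/eqP x0|xV].
  by apply: val_inj; rewrite /eisenstein_inv val_insubd x0 invr0 if_same.
by apply: val_inj; rewrite /eisenstein_inv val_insubd (negbTE xV).
Qed.

HB.instance Definition _ := GRing.ComNzRing_hasMulInverse.Build eisenstein
  eisenstein_mulVx eisenstein_unitPl eisenstein_invr_out.

Lemma eisenstein_integral (x y : eisenstein) :
  x * y = 0 -> (x == 0) || (y == 0).
Proof.
move=> xy0; have /eqP : val x * val y = 0 by rewrite -rmorphM xy0 rmorph0.
by rewrite mulf_eq0 -!(inj_eq val_inj) !rmorph0.
Qed.

HB.instance Definition _ :=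
  GRing.ComUnitRing_isIntegral.Build eisenstein eisenstein_integral.

Local Open Scope classical_set_scope.

(* The classes, up to associates, of the primes dividing x *)
Definition prime_divisor_classes (x : eisenstein) : set (set eisenstein) :=
  [set associates p | p in [set p | prime_elt p /\ divides p x]].

(* The value is extended because every prime divides 0: [counting] returns
   +oo on an infinite set and the cardinality of a finite one. *)
Definition omegaE (x : eisenstein) : \bar R :=
  counting (prime_divisor_classes x).

End Eisenstein.

(* Main.v *)
(* For rho <> -1 and a prime p, write v for the p-adic valuation. The condition
   v(a + rho b) > v((1 + rho) a) relates each a to essentially one b, each b to
   essentially one a, and no a to itself. Such a graph is 3-colourable, so a
   third of the set survives with v(a + rho b) <= v((1 + rho) a) throughout.
   After doing this for each of the k primes dividing the product, a + rho b
   divides (1 + rho) a for all a <> b that are left, which bounds the number of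
   survivors in terms of rho: hence |A| <= 3^k B.

   For rho = -1, any rational prime q with q^2 < |A| divides some difference
   a - b by the pigeonhole principle, and Chebyshev's lower bound provides
   enough of them. *)

Require Import Defs.
From mathcomp Require Import all_boot all_order all_algebra finmap.
From mathcomp Require Import complex ring zify.
From mathcomp Require Import all_classical reals constructive_ereal.
From mathcomp Require Import counting_measure exp.

Set Implicit Arguments.
Unset Strict Implicit.
Unset Printing Implicit Defensive.

Import Order.TTheory GRing.Theory Num.Theory.

(** * Three-colourings *)

Lemma color_avoid (i j : 'I_3) : exists c : 'I_3, c != i /\ c != j.
Proof.
have: 0 < #|~: [set i; j]|.
  by rewrite cardsCs finset.setCK card_ord cards2; case: (i != j).
by case/card_gt0P=> c; rewrite !inE negb_or => /andP[]; exists c.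
Qed.

(** On [s], [r] is an equivalence and [e] descends to a loopless digraph on its classes with in- and
    out-degree at most one. Colour greedily: a new element copies the colour of a coloured member of
    its class; failing that, it has at most one class of successors and one of predecessors, which
    leaves a third colour free. *)
Lemma three_coloring (T : eqType) (e r : rel T) (s : seq T) :
    {in s, forall a, ~~ e a a} -> {in s, reflexive r} ->
    {in s & &, forall a b c, r a b -> r a c -> r b c} ->
    {in s & &, forall a b c, e a b -> e a c -> r b c} ->
    {in s & &, forall a b c, e b a -> e c a -> r b c} ->
    {in s & &, forall a b c, r a b -> e a c -> e b c} ->
    {in s & &, forall a b c, r a b -> e c a -> e c b} ->
  exists f : T -> 'I_3, {in s &, forall a b, e a b -> f a != f b} /\
                        {in s &, forall a b, r a b -> f a = f b}.
Proof.
elim: s => [|x s IHs] irr rr rt eo ei er re; first by exists (fun=> ord0).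
have xs : {subset s <= x :: s} by move=> y; rewrite inE orbC => ->.
have xx : x \in x :: s by rewrite inE eqxx.
have {IHs} [|||||||f [fe fr]] := IHs; try by move=> *; eauto.
have [c cP] : exists c, forall y, y \in s -> [/\ e x y -> c != f y,
    e y x -> c != f y & r x y -> c = f y].
  have [/hasP[z zs rz]|/hasPn nr] := boolP (has (r x) s).
    exists (f z) => y ys; split=> [exy|eyx|rxy].
    - by apply: fe => //; apply: (er x) => //; exact: xs.
    - by rewrite eq_sym; apply: fe => //; apply: (re x) => //; exact: xs.
    - by apply: fr => //; apply: (rt x) => //; exact: xs.
  (* All successors of [x] lie in one class and so share the colour [i]; likewise [j] below for the
     predecessors. *)
  have [i iP] : exists i, forall y, y \in s -> e x y -> i = f y.
    have [/hasP[z zs ez]|/hasPn no] := boolP (has (e x) s); last first.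
      by exists ord0 => y /no /negP.
    by exists (f z) => y ys ey; apply: fr => //; apply: (eo x) => //; exact: xs.
  have [j jP] : exists j, forall y, y \in s -> e y x -> j = f y.
    have [/hasP[z zs ez]|/hasPn no] := boolP (has (e^~ x) s); last first.
      by exists ord0 => y /no /negP.
    by exists (f z) => y ys ey; apply: fr => //; apply: (ei x) => //; exact: xs.
  have [c [ci cj]] := color_avoid i j; exists c => y ys; split.
  - by move/(iP _ ys) <-.
  - by move/(jP _ ys) <-.
  - by move=> rxy; have /negP := nr _ ys.
have rsym : {in x :: s &, forall a b, r a b -> r b a}.
  by move=> a b ai bi rab; apply: (rt a) => //; exact: rr.
exists (fun y => if y == x then c else f y); split=> a b.
  rewrite !inE; case: (eqVneq a x) => [->|_]; case: (eqVneq b x) => [->|_] //=.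
  - by rewrite (negbTE (irr x xx)).
  - by move=> _ /cP[].
  - by move=> /cP[_ h _] _ /h; rewrite eq_sym.
  - exact: fe.
rewrite !inE; case: (eqVneq a x) => [->|_]; case: (eqVneq b x) => [->|_] //=.
- by move=> _ /cP[].
- move=> ai _ rax; have [_ _ ->] // := cP _ ai.
  by apply: rsym => //; exact: xs.
- exact: fr.
Qed.

Lemma large_color_class (T : Type) (f : T -> 'I_3) (s : seq T) :
  exists c, size s <= 3 * size [seq x <- s | f x == c].
Proof.
have sumE : size s = \sum_(c < 3) size [seq x <- s | f x == c].
  elim: s => [|x s IHs] /=; first by rewrite big1.
  rewrite {}IHs (bigD1 (f x)) //= [RHS](bigD1 (f x)) //= eqxx /= addSn.
  by congr (_ + _).+1; apply: eq_bigr => c /negbTE cf; rewrite eq_sym cf.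
apply/existsP; apply: contraT => /existsPn small.
move: (small ord0) (small (lift ord0 ord0)) (small ord_max).
move: sumE; rewrite !big_ord_recr big_ord0 /= => sumE.
rewrite (_ : widen_ord _ _ = ord0) in sumE; last exact: val_inj.
rewrite (_ : widen_ord _ _ = lift ord0 ord0) in sumE; last exact: val_inj.
by rewrite sumE; lia.
Qed.

(** * Chebyshev's lower bound *)

(** By Legendre's formula the exponent is the sum over k of floor(2m / p^k) - 2 floor(m / p^k). Each
    term is 0 or 1, and it vanishes once p^k > 2m. *)
Lemma logn_central_bin_le p m : prime p ->
  logn p 'C(m.*2, m) <= trunc_log p m.*2.
Proof.
move=> pp; have p1 := prime_gt1 pp.
have le_m : m <= m.*2 by rewrite -addnn leq_addr.
have /(congr1 (logn p)) := bin_fact le_m.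
have -> : m.*2 - m = m by rewrite -addnn addnK.
rewrite !lognM ?muln_gt0 ?fact_gt0 ?bin_gt0 //.
rewrite !logn_fact // => eqn.
have : \sum_(1 <= k < m.*2.+1) m.*2 %/ p ^ k
    <= \sum_(1 <= k < m.*2.+1) (m %/ p ^ k).*2
       + \sum_(1 <= k < m.*2.+1) (k <= trunc_log p m.*2).
  rewrite -big_split /=; apply: leq_sum => k _.
  have pk : 0 < p ^ k by rewrite expn_gt0 prime_gt0.
  have [kt|kt] := leqP k (trunc_log p m.*2) => /=.
    rewrite -ltnS ltn_divLR //.
    have := ltn_ceil m pk; nia.
  rewrite divn_small //.
  apply: leq_trans (trunc_log_ltn _ p1) _; exact: leq_pexp2l (prime_gt0 pp) kt.
(* The terms with k > m vanish because m < p^k. *)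
have -> : \sum_(1 <= k < m.*2.+1) (m %/ p ^ k).*2
        = (\sum_(1 <= k < m.+1) m %/ p ^ k).*2.
  rewrite -[RHS]mul2n big_distrr /= (@big_cat_nat _ _ _ m.+1) //=.
  rewrite [X in _ + X]big_nat_cond [X in _ + X]big1 ?addn0; last first.
    move=> k; rewrite andbT => /andP[mk _]; rewrite divn_small //.
    by apply: leq_trans (ltnW (ltn_expl k p1)); exact: mk.
  by apply: eq_bigr => k _; rewrite mul2n.
have : \sum_(1 <= k < m.*2.+1) (k <= trunc_log p m.*2) <= trunc_log p m.*2.
  rewrite -big_mkcond /= sum1_count.
  rewrite -[X in _ <= X](size_iota 1) -size_filter; apply: uniq_leq_size.
    by rewrite filter_uniq // iota_uniq.
  by move=> k; rewrite mem_filter !mem_iota; lia.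
move: eqn; set U := (\sum_(1 <= k < m.*2.+1) m.*2 %/ p ^ k).
set V := (\sum_(1 <= k < m.+1) _); set W := \sum_(_ <= k < _) (_ <= _).
set L := logn p _; set T := trunc_log _ _; lia.
Qed.

(** By Pascal's rule the next central coefficient is a sum of two terms, equal by symmetry, each at
    least the present one. *)
Lemma central_bin_ge m : 2 ^ m <= 'C(m.*2, m).
Proof.
elim: m => [//|m IHm]; rewrite doubleS binS expnS mul2n -addnn leq_add //.
  by rewrite binS; apply: leq_trans IHm _; rewrite leq_addl.
apply: leq_trans IHm _; rewrite -[X in _ <= X]bin_sub; last by lia.
have -> : m.*2.+1 - m = m.+1 by lia.
by rewrite binS leq_addl.
Qed.

(* Chebyshev: the prime powers dividing 'C(2m, m) are at most 2m. *)
Lemma chebyshev_central_bin m : 0 < m ->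
  2 ^ m <= m.*2 ^ size (primes 'C(m.*2, m)).
Proof.
move=> m0; apply: leq_trans (central_bin_ge m) _.
have bin0 : 0 < 'C(m.*2, m) by rewrite bin_gt0; lia.
rewrite [X in X <= _](prod_prime_decomp bin0) prime_decompE big_map /=.
rewrite -[X in _ <= _ ^ X]sum1_size expn_sum big_seq [X in _ <= X]big_seq.
apply: leq_prod => p; rewrite mem_primes => /and3P[pp _ _]; rewrite expn1.
apply: leq_trans (leq_pexp2l (prime_gt0 pp) (logn_central_bin_le m pp)) _.
by apply: trunc_logP; [exact: prime_gt1 | lia].
Qed.

Lemma prime_dvd_fact p n : prime p -> p %| n`! -> p <= n.
Proof.
move=> pp; elim: n => [|n IHn].
  by rewrite fact0 dvdn1 => /eqP p1; rewrite p1 in pp.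
rewrite factS Euclid_dvdM // => /orP[/dvdn_leq -> //|/IHn].
exact: leqW.
Qed.

Lemma primes_central_bin_le m p : p \in primes 'C(m.*2, m) -> p <= m.*2.
Proof.
rewrite mem_primes => /and3P[pp _ pdvd].
have le_m : m <= m.*2 by lia.
by apply: prime_dvd_fact => //; rewrite -(bin_fact le_m) dvdn_mulr.
Qed.

(** Chebyshev's bound with m = 2^(t-1) gives at least 2^(t-1) / t primes up to 2^t. The count 2t is
    what the case rho = -1 needs: it yields 3^(2t) = 9^t, to be compared with 4^t. *)
Lemma many_primes_below_pow2 t : 8 <= t -> exists s : seq nat,
  [/\ uniq s, all prime s, all (leq^~ (2 ^ t)) s & t.*2 <= size s].
Proof.
move=> t8; exists (primes 'C((2 ^ t.-1).*2, 2 ^ t.-1)).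
have twoE : (2 ^ t.-1).*2 = 2 ^ t by rewrite -mul2n -expnS prednK //; lia.
split; first exact: primes_uniq.
- by apply/allP=> p; rewrite mem_primes => /and3P[].
- by apply/allP=> p /primes_central_bin_le; rewrite twoE.
have := @chebyshev_central_bin (2 ^ t.-1); rewrite twoE expn_gt0 => /(_ isT).
rewrite -expnM leq_exp2l //.
(* Equality holds at t = 8, whence the threshold. *)
have : t * t.*2 <= 2 ^ t.-1.
  case: t t8 {twoE} => // t t8 /=; elim: t t8 => // t IHt.
  rewrite leq_eqVlt => /orP[/eqP [<-] //|t7].
  by rewrite expnS; have := IHt t7; nia.
move=> h1 h2; have := leq_trans h1 h2; rewrite leq_pmul2l //; lia.
Qed.

Local Open Scope ring_scope.

(** * Arithmetic of the Eisenstein integers *)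

Section EisensteinArithmetic.
Variable R : realType.
Local Notation E := (eisenstein R).
Implicit Types (x y z p d : E) (a b : int).

Fact omega_eisenstein : omega R \in eisenstein_pred (R := R).
Proof. by apply/asboolP; exists 0, 1; rewrite mul1r add0r. Qed.

Definition eis a b : E := a%:~R + b%:~R * Eisenstein omega_eisenstein.

Lemma val_eis a b : val (eis a b) = a%:~R + b%:~R * omega R.
Proof. by rewrite rmorphD rmorphM !rmorph_int. Qed.

Fact eis_coords_subproof x : exists c : int * int, x = eis c.1 c.2.
Proof.
have /asboolP[a [b xE]] := valP x; exists (a, b).
by apply: val_inj; rewrite val_eis.
Qed.

Definition coords x : int * int := sval (cid (eis_coords_subproof x)).

Lemma coordsK x : eis (coords x).1 (coords x).2 = x.
Proof. by rewrite /coords; case: cid. Qed.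

(** The squared complex modulus as a natural number; by [enormE] it does not depend on the
    coordinates chosen. *)
Definition enorm x : nat :=
  absz ((coords x).1 ^+ 2 - (coords x).1 * (coords x).2 + (coords x).2 ^+ 2).

Lemma conj_omega : (omega R)^* = - 1 - omega R.
Proof.
have sJ : ((Num.sqrt 3)%:C%C : R[i])^* = (Num.sqrt 3)%:C%C.
  by apply: geC0_conj; rewrite ler0c sqrtr_ge0.
rewrite /omega; set s := (_)%:C%C in sJ *.
rewrite rmorphM fmorphV rmorphD rmorphN1 rmorphM /= conjCi sJ conjC_nat.
by field.
Qed.

Lemma conj_val_eis a b : (val (eis a b))^* = a%:~R - b%:~R * (1 + omega R).
Proof.
rewrite val_eis rmorphD rmorphM /= !(rmorph_int (@Num.conj R[i])) conj_omega.
by ring.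
Qed.

Lemma sqr_norm_eis a b :
  `|val (eis a b)| ^+ 2 = (absz (a ^+ 2 - a * b + b ^+ 2))%:R.
Proof.
have pos : 0 <= a ^+ 2 - a * b + b ^+ 2 by nia.
rewrite -[RHS]/((absz _)%:Z%:~R) gez0_abs // normCK conj_val_eis val_eis.
rewrite [LHS](_ : _ = a%:~R ^+ 2 - a%:~R * b%:~R
    - b%:~R ^+ 2 * (omega R + omega R * omega R)); last by ring.
by rewrite omega_sqr !(rmorphD, rmorphB, rmorphM, rmorphXn) /=; ring.
Qed.

Lemma enormE x : (enorm x)%:R = `|val x| ^+ 2.
Proof. by rewrite -[in RHS](coordsK x) sqr_norm_eis. Qed.

Lemma enorm_eis a b : enorm (eis a b) = absz (a ^+ 2 - a * b + b ^+ 2).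
Proof. by apply/eqP; rewrite -(eqr_nat R[i]) enormE sqr_norm_eis. Qed.

Lemma enormM x y : enorm (x * y) = (enorm x * enorm y)%N.
Proof.
apply/eqP; rewrite -(eqr_nat R[i]) natrM !enormE.
by rewrite rmorphM normrM exprMn.
Qed.

Lemma enorm_eq0 x : (enorm x == 0%N) = (x == 0).
Proof.
rewrite -(eqr_nat R[i]) enormE sqrf_eq0 normr_eq0.
by rewrite -(inj_eq val_inj) rmorph0.
Qed.

Lemma enorm_gt0 x : (0 < enorm x)%N = (x != 0).
Proof. by rewrite lt0n enorm_eq0. Qed.

Lemma enorm_nat n : enorm n%:R = (n ^ 2)%N.
Proof.
apply/eqP; rewrite -(eqr_nat R[i]) natrX enormE rmorph_nat.
by rewrite normr_nat.
Qed.

Lemma enormN x : enorm (- x) = enorm x.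
Proof. by apply/eqP; rewrite -(eqr_nat R[i]) !enormE rmorphN normrN. Qed.

(* Parallelogram law. *)
Lemma enormD_le x y : (enorm (x + y)%R <= 2 * (enorm x + enorm y))%N.
Proof.
rewrite -(ler_nat R[i]) natrM natrD !enormE -subr_ge0.
rewrite (_ : _ - _ = `|val (x - y)| ^+ 2) ?exprn_ge0 //.
rewrite !normCK !(rmorphB, rmorphD) /=; ring.
Qed.

Lemma enorm_unit x : (x \is a GRing.unit) = (enorm x == 1%N).
Proof.
apply/idP/idP => [xU|/eqP x1].
  have := enorm_nat 1; rewrite -(mulrV xU) enormM => /eqP.
  by rewrite muln_eq1 => /andP[].
have xxJ : val x * (val x)^* = 1 by rewrite -normCK -enormE x1.
have x0 : val x != 0.
  by apply/eqP=> x0; move/eqP: xxJ; rewrite x0 mul0r eq_sym oner_eq0.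
apply/andP; split=> //.
have -> : (val x)^-1 = (val x)^* by apply: (mulfI x0); rewrite divff.
rewrite -(coordsK x) conj_val_eis; move: (coords x).1 (coords x).2 => a b.
(* The inverse is the conjugate, and the conjugate of a + b omega is (a - b) - b omega. *)
by apply/asboolP; exists (a - b), (- b); rewrite rmorphB rmorphN /=; ring.
Qed.

Lemma round_div (c : int) (n : nat) : (0 < n)%N ->
  exists q : int, `|2 * (c - q * n%:Z)| <= n%:Z.
Proof.
move=> n0; exists ((2 * c + n%:Z) %/ (2 * n%:Z))%Z.
have := divz_eq (2 * c + n%:Z) (2 * n%:Z).
have := @modz_ge0 (2 * c + n%:Z) (2 * n%:Z).
have := @ltz_pmod (2 * c + n%:Z) (2 * n%:Z).
move: (_ %/ _)%Z (_ %% _)%Z => q r; lia.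
Qed.

Lemma exists_conj y : exists z, y * z = (enorm y)%:R.
Proof.
exists (eis ((coords y).1 - (coords y).2) (- (coords y).2)).
apply: val_inj; rewrite rmorph_nat enormE normCK.
rewrite -[LHS]/(val y * val _) val_eis.
rewrite -[X in _ * (val X)^*](coordsK y) conj_val_eis.
by rewrite rmorphB rmorphN /=; ring.
Qed.

(** With z the conjugate of y and N its norm, round both coordinates of x z / N to nearest integers.
    The errors r1, r2 satisfy |2 ri| <= N, so r1^2 - r1 r2 + r2^2 is at most 3/4 N^2. *)
Lemma eis_euclid x y : y != 0 -> exists q, (enorm (x - q * y)%R < enorm y)%N.
Proof.
move=> y0; have n0 : (0 < enorm y)%N by rewrite enorm_gt0.
have [z yz] := exists_conj y.
have [q1 q1P] := round_div (coords (x * z)).1 n0.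
have [q2 q2P] := round_div (coords (x * z)).2 n0.
exists (eis q1 q2).
have z0 : (0 < enorm z)%N.
  by move: (congr1 enorm yz); rewrite enormM enorm_nat; nia.
rewrite -(ltn_pmul2r z0) -!enormM yz enorm_nat.
have -> : (x - eis q1 q2 * y) * z = eis ((coords (x * z)).1 - q1 * (enorm y)%:Z)
                                      ((coords (x * z)).2 - q2 * (enorm y)%:Z).
  rewrite mulrBl -mulrA yz -[in LHS](coordsK (x * z)) /eis.
  by rewrite !rmorphB !rmorphM /= -!pmulrn; ring.
rewrite enorm_eis; move: q1P q2P; move: (_ - _) (_ - _) => r2 r1 r1P r2P.
suff : 4 * (r1 ^+ 2 - r1 * r2 + r2 ^+ 2) < 4 * (enorm y)%:Z ^+ 2.
  have pos : 0 <= r1 ^+ 2 - r1 * r2 + r2 ^+ 2 by nia.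
  by rewrite ltr_pM2l // -ltz_nat gez0_abs // -mulnn PoszM expr2.
have b1 : (2 * r1) ^+ 2 <= (enorm y)%:Z ^+ 2.
  by rewrite -(ger0_norm (sqr_ge0 _)) normrX lerXn2r.
have b2 : (2 * r2) ^+ 2 <= (enorm y)%:Z ^+ 2.
  by rewrite -(ger0_norm (sqr_ge0 _)) normrX lerXn2r.
have := sqr_ge0 (r1 + r2).
have n1 : 0 < (enorm y)%:Z ^+ 2 by rewrite exprn_gt0.
nia.
Qed.

Lemma enorm_ball (K : nat) :
  exists l : seq E, forall x, (enorm x <= K)%N -> x \in l.
Proof.
pose i : seq int := [seq k%:Z - (2 * K)%:Z | k <- iota 0 (4 * K).+1].
exists [seq eis a b | a <- i, b <- i] => x xK.
move: xK; rewrite -(coordsK x) enorm_eis.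
move: (coords x).1 (coords x).2 => a b abK.
have inI (c : int) : - (2 * K)%:Z <= c -> c <= (2 * K)%:Z -> c \in i.
  move=> c1 c2; apply/mapP; exists (absz (c + (2 * K)%:Z)); last by lia.
  by rewrite mem_iota; lia.
have abK2 : a ^+ 2 - a * b + b ^+ 2 <= K%:Z by lia.
(* Completing the square gives 3 c^2 <= 4 K, hence |c| <= c^2 <= 2 K. *)
have small (c e : int) : c ^+ 2 - c * e + e ^+ 2 <= K%:Z -> c \in i.
  move=> ceK; have := sqr_ge0 (c - 2 * e).
  have -> : (c - 2 * e) ^+ 2
      = 4 * (c ^+ 2 - c * e + e ^+ 2) - 3 * c ^+ 2 by ring.
  move=> c2; have c2K : 3 * c ^+ 2 <= 4 * K%:Z by lia.
  have c1 : c <= c ^+ 2 by nia.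
  have c1' : - c <= c ^+ 2 by nia.
  by apply: inI; lia.
apply: allpairs_f; first exact: (small a b).
by apply: (small b a); rewrite (_ : _ + _ = a ^+ 2 - a * b + b ^+ 2) //; ring.
Qed.

Lemma eis_pigeonhole (q : nat) (s : seq E) : (0 < q)%N -> uniq s ->
    (q ^ 2 < size s)%N ->
  exists x y, [/\ x \in s, y \in s, x != y & divides q%:R (x - y)].
Proof.
move=> q0 us ltqs.
pose f x := (((coords x).1 %% q)%Z, ((coords x).2 %% q)%Z).
have [inj|] := pselect {in s &, injective f}.
  pose i : seq int := [seq k%:Z | k <- iota 0 q].
  have : (size (map f s) <= size [seq (a, b) | a <- i, b <- i])%N.
    apply: uniq_leq_size; first by rewrite map_inj_in_uniq.
    move=> _ /mapP[x _ ->].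
    have inI (c : int) : (c %% q)%Z \in i.
      apply/mapP; exists (absz (c %% q)%Z); last first.
        by rewrite gez0_abs // modz_ge0 //; lia.
      have := @ltz_pmod c q; have := @modz_ge0 c q.
      by rewrite mem_iota; lia.
    by apply: allpairs_f.
  by rewrite size_allpairs !size_map size_iota; lia.
move=> /existsNP[x /existsNP[y /not_implyP[xs]]].
move=> /not_implyP[ys /not_implyP[fxy xy]].
exists x, y; split=> //; first exact/eqP.
case: fxy => /eqP e1 /eqP e2.
have /dvdzP[c1 c1E] : (q %| (coords x).1 - (coords y).1)%Z.
  by rewrite -eqz_mod_dvd.
have /dvdzP[c2 c2E] : (q %| (coords x).2 - (coords y).2)%Z.
  by rewrite -eqz_mod_dvd.
exists (eis c1 c2).
have -> : x - y = eis ((coords x).1 - (coords y).1)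
                      ((coords x).2 - (coords y).2).
  by rewrite -{1}(coordsK x) -{1}(coordsK y) /eis !rmorphB /=; ring.
by rewrite c1E c2E /eis !rmorphM /= -!pmulrn; ring.
Qed.

End EisensteinArithmetic.

(** * Divisibility in an integral domain *)

Section DividesTheory.
Variable D : idomainType.
Implicit Types p x y z : D.

Lemma divides_refl x : divides x x.
Proof. by exists 1; rewrite mul1r. Qed.

Lemma divides0 x : divides x 0.
Proof. by exists 0; rewrite mul0r. Qed.

Lemma divides_trans x y z : divides x y -> divides y z -> divides x z.
Proof. by move=> [u ->] [v ->]; exists (v * u); rewrite mulrA. Qed.

Lemma dividesD p x y : divides p x -> divides p y -> divides p (x + y).
Proof. by move=> [u ->] [v ->]; exists (u + v); rewrite mulrDl. Qed.

Lemma dividesN p x : divides p x -> divides p (- x).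
Proof. by move=> [u ->]; exists (- u); rewrite mulNr. Qed.

Lemma dividesB p x y : divides p x -> divides p y -> divides p (x - y).
Proof. by move=> px py; apply/dividesD/dividesN. Qed.

Lemma divides_mull p x y : divides p x -> divides p (y * x).
Proof. by move=> [u ->]; exists (y * u); rewrite mulrA. Qed.

Lemma divides_mulr p x y : divides p x -> divides p (x * y).
Proof. by rewrite mulrC; exact: divides_mull. Qed.

Lemma divides_exp p m n : (m <= n)%N -> divides (p ^+ m) (p ^+ n).
Proof. by move=> mn; exists (p ^+ (n - m)); rewrite -exprD subnK. Qed.

Lemma divides_prod (I : eqType) (s : seq I) (P : pred I) (F : I -> D) i :
  i \in s -> P i -> divides (F i) (\prod_(j <- s | P j) F j).
Proof.
elim: s => // j s IHs; rewrite inE big_cons => /orP[/eqP <-|/IHs h] Pi.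
  by rewrite Pi; exact/divides_mulr/divides_refl.
by case: ifP => _; [exact/divides_mull/h | exact: h].
Qed.

Lemma prime_elt_exp p n x : prime_elt p -> ~ divides p x ->
  forall y, divides (p ^+ n) (x * y) -> divides (p ^+ n) y.
Proof.
move=> [p0 _ pp] px; elim: n => [|n IHn] y; first by exists y; rewrite mulr1.
move=> pxy; have : divides p (x * y).
  by apply: divides_trans pxy; rewrite exprS; exact/divides_mulr/divides_refl.
case/pp => // -[z yE]; rewrite {}yE in pxy *.
case: pxy => u; rewrite exprSr !mulrA => /(mulIf p0) xzE.
by have [|v ->] := IHn z; [exists u | exists v; rewrite mulrA].
Qed.

Lemma prime_elt_not_divides1 p : prime_elt p -> ~ divides p 1.
Proof.
move=> [_ /negP pU _] [u uE]; apply: pU; apply/unitrPr.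
by exists u; rewrite mulrC -uE.
Qed.

End DividesTheory.

(** * Prime divisors and valuations in the Eisenstein integers *)

Section EisensteinPrimes.
Variable R : realType.
Local Notation E := (eisenstein R).
Implicit Types (p d x y z : E).

Lemma enorm_divides x y : divides x y -> y != 0 -> (enorm x <= enorm y)%N.
Proof.
move=> [z ->]; rewrite mulf_eq0 negb_or -enorm_gt0 enormM => /andP[z0 _].
by rewrite leq_pmull.
Qed.

Lemma nonunit_enorm_gt1 x : x != 0 -> x \isn't a GRing.unit -> (1 < enorm x)%N.
Proof. by rewrite enorm_unit -enorm_gt0; case: (enorm x) => [|[]]. Qed.

(** Take for g a nonzero element of least norm in the ideal (x, y): division by g leaves a remainder
    in the ideal, which must be 0. *)
Lemma eis_bezout x y : x != 0 ->
  exists g, [/\ divides g x, divides g y & exists u v, g = u * x + v * y].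
Proof.
move=> x0.
pose P n := `[< exists u v, u * x + v * y != 0 /\ enorm (u * x + v * y) = n >].
have exP : exists n, P n.
  by exists (enorm x); apply/asboolP; exists 1, 0; rewrite mul1r mul0r addr0.
have [n /asboolP[u [v [g0 gn]]] nmin] := ex_minnP exP.
set g := u * x + v * y in g0 gn.
have gdvd u' v' : divides g (u' * x + v' * y).
  have [q qlt] := eis_euclid (u' * x + v' * y) g0.
  exists q; apply/eqP; rewrite -subr_eq0; apply: contraLR qlt => r0.
  rewrite -leqNgt gn; apply: nmin; apply/asboolP.
  exists (u' - q * u), (v' - q * v).
  suff -> : (u' - q * u) * x + (v' - q * v) * y
          = u' * x + v' * y - q * g by split.
  by rewrite /g; ring.
exists g; split; last by exists u, v.
- by have := gdvd 1 0; rewrite mul1r mul0r addr0.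
- by have := gdvd 0 1; rewrite mul1r mul0r add0r.
Qed.

(** A nonunit divisor p of least norm is prime. If p divides y z, let g be a gcd of p and y: when g
    is a unit, Bezout gives p | z; otherwise minimality makes g an associate of p, so p | y. *)
Lemma exists_prime_divisor x : x != 0 -> x \isn't a GRing.unit ->
  exists2 p, prime_elt p & divides p x.
Proof.
move=> x0 xU.
pose P n :=
  `[< exists p, [/\ divides p x, p \isn't a GRing.unit & enorm p = n] >].
have exP : exists n, P n.
  by exists (enorm x); apply/asboolP; exists x; split=> //; exact: divides_refl.
have [n /asboolP[p [px pU pn]] nmin] := ex_minnP exP.
have p0 : p != 0.
  by apply: contraNneq x0 => p0; case: px => z ->; rewrite p0 mulr0.
exists p => //; split=> // y z pyz.
have [py|npy] := pselect (divides p y); [by left | right].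
have [g [gp gy [u [v gE]]]] := eis_bezout y p0.
have [gU|gU] := boolP (g \is a GRing.unit).
  have -> : z = g^-1 * (u * z * p + v * (y * z)).
    apply: (mulrI gU); rewrite mulVKr // gE; ring.
  apply: divides_mull; apply: dividesD; apply: divides_mull => //.
  exact: divides_refl.
have : (n <= enorm g)%N.
  by apply: nmin; apply/asboolP; exists g; split=> //; exact: divides_trans px.
case: gp gE => h pE gE; have := pn; rewrite pE enormM => hn ng.
have hU : h \is a GRing.unit.
  rewrite enorm_unit; move: p0; rewrite -enorm_gt0 pE enormM; nia.
case: npy; apply: divides_trans gy; exists h^-1.
by rewrite pE mulKr.
Qed.

Lemma prime_elt_pow_bound p x : prime_elt p -> x != 0 ->
  forall n, divides (p ^+ n) x -> (n <= enorm x)%N.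
Proof.
move=> [p0 pU _] x0 n /enorm_divides/(_ x0).
have -> : enorm (p ^+ n) = (enorm p ^ n)%N.
  elim: n => [|n IHn]; last by rewrite exprS enormM IHn expnS.
  by rewrite expr0 expn0 -[1]/(1%:R) enorm_nat.
apply: leq_trans; apply/ltnW/ltn_expl; exact: nonunit_enorm_gt1.
Qed.

(* [vp p 0] is the junk value 0. *)
Definition vp p x : nat :=
  xget 0%N [set m | forall n, divides (p ^+ n) x <-> (n <= m)%N].

Lemma vpP p x : prime_elt p -> x != 0 ->
  forall n, divides (p ^+ n) x <-> (n <= vp p x)%N.
Proof.
move=> pp x0.
suff [m mP] : exists m, forall n, divides (p ^+ n) x <-> (n <= m)%N.
  by rewrite /vp; case: xgetP => [m' _ //|/(_ m) /(_ mP)].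
have exP : exists n, `[< divides (p ^+ n) x >].
  by exists 0%N; apply/asboolP; exists x; rewrite expr0 mulr1.
have bound n : `[< divides (p ^+ n) x >] -> (n <= enorm x)%N.
  by move/asboolP; exact: prime_elt_pow_bound.
have [m /asboolP mx mmax] := ex_maxnP exP bound.
exists m => n; split=> [nx|nm]; first by apply: mmax; apply/asboolP.
exact: divides_trans (divides_exp p nm) mx.
Qed.

Lemma vp_decomp p x : prime_elt p -> x != 0 ->
  exists2 z, x = z * p ^+ vp p x & ~ divides p z.
Proof.
move=> pp x0; have [_ /(_ (leqnn _)) [z xE]] := vpP pp x0 (vp p x).
exists z => // -[w zE]; have : divides (p ^+ (vp p x).+1) x.
  by exists w; rewrite {1}xE zE exprS mulrA.
by move/(vpP pp x0); rewrite ltnn.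
Qed.

Lemma vpM p x y : prime_elt p -> x != 0 -> y != 0 ->
  vp p (x * y) = (vp p x + vp p y)%N.
Proof.
move=> pp x0 y0; have xy0 : x * y != 0 by rewrite mulf_neq0.
have [x' xE px'] := vp_decomp pp x0; have [y' yE py'] := vp_decomp pp y0.
have [p0 _ pM] := pp.
apply/eqP; rewrite eqn_leq; apply/andP; split; last first.
  apply/(vpP pp xy0); move: (vp p x) (vp p y) xE yE => m n -> ->.
  by exists (x' * y'); rewrite exprD mulrACA.
rewrite leqNgt; apply/negP => /(vpP pp xy0).
move: (vp p x) (vp p y) xE yE => m n xE yE [z].
rewrite xE yE exprS exprD mulrACA => e.
have [|//|//] := pM x' y'; exists z.
have pmn0 : p ^+ m * p ^+ n != 0 by rewrite mulf_neq0 ?expf_neq0.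
by apply: (mulIf pmn0); rewrite e !mulrA.
Qed.

(** Induction on the norm of x: cancel one prime p from both x and y, and check that the local
    condition survives at each prime r. *)
Lemma divides_local x y : x != 0 ->
    (forall p, prime_elt p -> divides p x ->
       forall n, divides (p ^+ n) x -> divides (p ^+ n) y) ->
  divides x y.
Proof.
have [n] := ubnP (enorm x); elim: n x y => // n IHn x y xn x0 loc.
have [xU|xU] := boolP (x \is a GRing.unit).
  by exists (y * x^-1); rewrite mulrVK.
have [p pp px] := exists_prime_divisor x0 xU.
have [p0 pU pM] := pp.
have [x' xE] := px; have x'0 : x' != 0.
  by apply: contraNneq x0 => x'0; rewrite xE x'0 mul0r.
have [|y' yE] := loc p pp px 1%N; first by rewrite expr1.
rewrite expr1 in yE.
have [|||u y'E] := IHn x' y'; last by exists u; rewrite yE y'E xE mulrA.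
- have := nonunit_enorm_gt1 p0 pU; have := xn; rewrite xE enormM.
  by rewrite -enorm_gt0 in x'0; nia.
- exact: x'0.
move=> r rp rx' m rmx'.
have rmx : divides (r ^+ m) x by rewrite xE; exact: divides_mulr.
have rx : divides r x by rewrite xE; exact: divides_mulr.
have := loc r rp rx; rewrite yE xE => {}loc.
have [rdp|rdp] := pselect (divides r p); last first.
  apply: (prime_elt_exp rp rdp); rewrite mulrC.
  by apply: loc; exact: divides_mulr.
have [w pE] := rdp.
have wU : w \is a GRing.unit.
  have [wp|[v rE]] : divides p w \/ divides p r.
  - by apply: pM; rewrite -pE; exact: divides_refl.
    case: wp => v wE; have [r0 rU _] := rp.
    have v1 : v * r = 1.
      by apply: (mulIf p0); rewrite mul1r -mulrA (mulrC r) mulrA -wE -pE.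
    by case/negP: rU; apply/unitrPr; exists v; rewrite mulrC.
  have v1 : w * v = 1 by apply: (mulIf p0); rewrite mul1r -mulrA -rE -pE.
  by apply/unitrPr; exists v.
have [u uE] : divides (r ^+ m.+1) (y' * p).
  apply: loc; rewrite exprSr; case: rmx' => v ->; exists (v * w).
  by rewrite {1}pE; ring.
have [r0 _ _] := rp.
exists (w^-1 * u); apply: (mulIf r0); apply: (mulrI wU).
rewrite -!mulrA mulVKr // -exprSr -uE pE; ring.
Qed.

End EisensteinPrimes.

(** * Thinning out the set *)

(** Meant for the norms n of rho, u of a + rho b, v of a' + rho b, b of b and w of a + rho a'. The
    factor 8 (1 + n) makes 4 (u + n v) at most b / 2, which the left side absorbs. *)
Lemma closeness_bound (n u v b w : nat) :
  (8 * (1 + n) * u <= b -> 8 * (1 + n) * v <= b ->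
   b <= 2 * (2 * (u + n * v) + w) -> b <= 4 * w)%N.
Proof.
move=> ub vb bw; suff : (8 * (u + n * v) <= b)%N by lia.
rewrite -(@leq_pmul2l (1 + n)%N) //.
have := leq_add ub (leq_mul (leqnn n) vb); lia.
Qed.

Section Thinning.
Variables (R : realType) (rho : eisenstein R).
Hypotheses (rho0 : rho != 0) (rho1 : 1 + rho != 0).
Local Notation E := (eisenstein R).
Implicit Types (p a b c d x y z : E) (s ps : seq E).

(** For nonzero x, v(x) < v(y). Stated by divisibility so that y = 0 counts as having infinite
    valuation, unlike [vp p 0]. *)
Definition vp_lt p x y := divides (p ^+ (vp p x).+1) y.

Lemma vp_lt_irr p x : prime_elt p -> x != 0 -> ~ vp_lt p x x.
Proof. by move=> pp x0 /(vpP pp x0); rewrite ltnn. Qed.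

Lemma vp_ltD_eq p x y : prime_elt p -> x != 0 -> y != 0 ->
  vp_lt p x (x + y) -> vp p x = vp p y.
Proof.
move=> pp x0 y0 xy; apply/eqP; rewrite eqn_leq; apply/andP; split.
  apply/(vpP pp y0); rewrite -[y](addKr x) addrC.
  apply: dividesB; last exact/(vpP pp x0).
  exact: divides_trans (divides_exp p (leqnSn _)) xy.
rewrite leqNgt; apply/negP => /(vpP pp y0) lty; apply: (vp_lt_irr pp x0).
by rewrite /vp_lt -[x in divides _ x](addrK y); exact: dividesB.
Qed.

Lemma vp_lt_divr p d x y : prime_elt p -> d != 0 -> x != 0 ->
  vp_lt p (d * x) y -> vp_lt p x y.
Proof.
move=> pp d0 x0; rewrite /vp_lt vpM //; apply: divides_trans.
by apply: divides_exp; rewrite ltnS leq_addl.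
Qed.

Lemma vp_lt_mul2l p d x y : prime_elt p -> d != 0 -> x != 0 ->
  vp_lt p (d * x) (d * y) <-> vp_lt p x y.
Proof.
move=> pp d0 x0; rewrite /vp_lt vpM //.
have [->|y0] := eqVneq y 0; first by rewrite mulr0; split=> _; exact: divides0.
have dy0 : d * y != 0 by rewrite mulf_neq0.
by rewrite vpP // vpM // -addnS leq_add2l vpP.
Qed.

Lemma vp_ltB_eq p x y : prime_elt p -> x != 0 -> y != 0 ->
  vp_lt p x (x - y) -> vp p x = vp p y.
Proof.
move=> pp x0 y0 /vp_ltD_eq -> //; last by rewrite oppr_eq0.
by rewrite -mulN1r vpM ?oppr_eq0 ?oner_eq0 // (_ : vp p (-1) = 0%N) //;
  apply/eqP; rewrite -leqn0 leqNgt; apply/negP => /(vpP pp);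
  rewrite oppr_eq0 oner_eq0 expr1 => /(_ isT) /dividesN; rewrite opprK;
  exact: prime_elt_not_divides1.
Qed.

(* Modulo [p ^+ (vp p ((1 + rho) * a)).+1], the relation
   [vp_lt p ((1 + rho) * a) (a + rho * b)] is a loopless graph of in- and
   out-degree at most one. *)
Lemma thin_prime p s : prime_elt p -> {in s, forall a, a != 0} ->
  exists s', [/\ subseq s' s, (size s <= 3 * size s')%N &
    {in s' &, forall a b, ~ vp_lt p ((1 + rho) * a) (a + rho * b)}].
Proof.
move=> pp s0; set h := 1 + rho.
pose e a b := `[< vp_lt p (h * a) (a + rho * b) >].
(* Congruence to the modulus attached to a. Related elements have the same valuation ([r_vp]), hence
   the same modulus, which makes [r] an equivalence on [s]. *)
pose r a b := `[< vp_lt p (h * a) (a - b) >].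
have hs0 : {in s, forall a, h * a != 0} by move=> a /s0; exact: mulf_neq0.
have r_vp a b : a \in s -> b \in s -> r a b -> vp p (h * a) = vp p (h * b).
  move=> /s0 a0 /s0 b0 /asboolP /(vp_lt_divr pp rho1 a0) /(vp_ltB_eq pp a0 b0).
  by rewrite !vpM // => ->.
have e_vp a b : a \in s -> b \in s -> e a b ->
    vp p (h * a) = vp p (rho * (h * b)).
  move=> /s0 a0 /s0 b0 /asboolP /(vp_lt_divr pp rho1 a0) /(vp_ltD_eq pp a0).
  rewrite mulf_neq0 // !vpM ?mulf_neq0 // => /(_ isT) ->.
  by rewrite addnCA.
have [|||||||f [fe fr]] := @three_coloring _ e r s.
- move=> a /s0 a0; apply/asboolPn.
  (* The factor 1 + rho in the threshold is there for this: on the diagonal a + rho a equals (1 +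
     rho) a, so there are no loops. *)
  rewrite (_ : a + rho * a = h * a); last by rewrite /h; ring.
  by apply: vp_lt_irr => //; rewrite mulf_neq0.
- by move=> a _; apply/asboolP; rewrite subrr; exact: divides0.
- move=> a b c sa sb sc rab rac; apply/asboolP; rewrite /vp_lt -(r_vp a) //.
  rewrite (_ : b - c = (a - c) - (a - b)); last by ring.
  by apply: dividesB; exact/asboolP.
- move=> a b c sa sb sc eab eac; apply/asboolP.
  (* By [e_vp] the modulus at a is p^(v(rho h b) + 1), so rho can be cancelled from rho (b - c). *)
  apply/(vp_lt_mul2l _ pp rho0 (hs0 _ sb)).
  rewrite /vp_lt -(e_vp a) //.
  rewrite (_ : rho * (b - c) = (a + rho * b) - (a + rho * c)); last by ring.
  by apply: dividesB; exact/asboolP.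
- move=> a b c sa sb sc eba eca; apply/asboolP.
  have bc : vp p (h * b) = vp p (h * c) by rewrite (e_vp b a) // (e_vp c a).
  move/asboolP: eba; move/asboolP: eca; rewrite /vp_lt bc => eca eba.
  rewrite (_ : b - c = (b + rho * a) - (c + rho * a)); last by ring.
  exact: dividesB eba eca.
- move=> a b c sa sb sc rab eac; apply/asboolP; rewrite /vp_lt -(r_vp a) //.
  rewrite (_ : b + rho * c = (a + rho * c) - (a - b)); last by ring.
  by apply: dividesB; exact/asboolP.
- move=> a b c sa sb sc rab eca; apply/asboolP.
  have {}rab : vp_lt p (rho * (h * a)) (rho * (a - b)).
    by apply/(vp_lt_mul2l _ pp rho0 (hs0 _ sa)); move/asboolP: rab.
  have ca := e_vp c a sc sa eca; move/asboolP: eca.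
  rewrite /vp_lt -ca in rab *; move=> eca.
  rewrite (_ : c + rho * b = (c + rho * a) - rho * (a - b)); last by ring.
  exact: dividesB eca rab.
have [c sc] := large_color_class f s.
exists [seq x <- s | f x == c]; split=> //; first exact: filter_subseq.
move=> a b; rewrite !mem_filter => /andP[/eqP fa sa] /andP[/eqP fb sb] eab.
by have := fe a b sa sb; rewrite fa fb eqxx => /(_ (asboolT eab)).
Qed.

Lemma thin_primes ps s : {in ps, forall p, prime_elt p} ->
    {in s, forall a, a != 0} ->
  exists s', [/\ subseq s' s, (size s <= 3 ^ size ps * size s')%N &
    {in ps, forall p,
      {in s' &, forall a b, ~ vp_lt p ((1 + rho) * a) (a + rho * b)}}].
Proof.
elim: ps s => [|p ps IHps] s psP s0; first by exists s; rewrite mul1n.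
have [|s1 [s1s szs1 s1P]] := @thin_prime p s _ s0.
  by apply: psP; rewrite inE eqxx.
have [||s2 [s2s1 szs2 s2P]] := IHps s1.
- by move=> q qps; apply: psP; rewrite inE qps orbT.
- by move=> a /(mem_subseq s1s); exact: s0.
exists s2; split; first exact: subseq_trans s1s.
  by rewrite expnS -mulnA; apply: leq_trans szs1 _; rewrite leq_pmul2l.
move=> q; rewrite inE => /orP[/eqP ->|qps]; last exact: s2P.
by move=> a b /(mem_subseq s2s1) sa /(mem_subseq s2s1) sb; exact: s1P.
Qed.

(* If [a + rho * b] divides [(1 + rho) * a] then it divides
   [d = rho * (1 + rho) * b] too, say [d * b = t * (a + rho * b)]. For fixed b,
   few a have [t] of small norm. When [t] is large, a is close to
   [- rho * b]; two such a, a' make [a + rho * a'] close to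
   [- rho * (1 + rho) * b], so that the quotient belonging to (a, a') is
   small. *)
Lemma mutual_divisor_bound : exists B : nat, forall s, uniq s ->
    {in s, forall a, a != 0} ->
    {in s &, forall a b, a != b -> divides (a + rho * b) ((1 + rho) * a)} ->
  (size s <= B)%N.
Proof.
have [d dE] : exists d, d = rho * (1 + rho) by exists (rho * (1 + rho)).
have d0 : d != 0 by rewrite dE mulf_neq0.
pose S := (8 * (1 + enorm rho) * enorm d)%N.
have [l lP] := enorm_ball R S.
(* For fixed b the quotient t determines a, and t ranges over a finite ball. *)
have few b s : b != 0 -> uniq s -> {in s, forall a, exists2 t,
    (enorm t <= S)%N & d * b = t * (a + rho * b)} -> (size s <= size l)%N.
  move=> b0 us sP.
  have /choice[f fP] : forall a, exists t, a \in s ->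
      (enorm t <= S)%N /\ d * b = t * (a + rho * b).
    move=> a; have [/sP[t t1 t2]|//] := boolP (a \in s); first by exists t.
    by exists 0.
  rewrite -(size_map f); apply: uniq_leq_size.
    rewrite map_inj_in_uniq // => a a' sa sa' faa'.
    have [_ e1] := fP a sa; have [_ e2] := fP a' sa'.
    have fa0 : f a != 0.
      apply: contraTneq (mulf_neq0 d0 b0) => fa0.
      by rewrite negbK e1 fa0 mul0r.
    by apply: (addIr (rho * b)); apply: (mulfI fa0); rewrite -e1 faa' -e2.
  by move=> _ /mapP[a sa ->]; apply: lP; case: (fP a sa).
(* The 2 counts the base point b and one far element a'; [few] is applied once to each. *)
exists (2 + 2 * size l)%N => s us s0 sP.
(* Since d b = (1 + rho) (a + rho b) - (1 + rho) a, a divisor a + rho b of the last term divides d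
   b. *)
have quo a b : a \in s -> b \in s -> a != b ->
    exists t, d * b = t * (a + rho * b).
  move=> sa sb /(sP a b sa sb) [t tE]; exists (1 + rho - t).
  by rewrite mulrBl -tE dE; ring.
case: s us s0 sP quo => [//|b s] /andP[bs us] s0 _ quo.
have b0 : b != 0 by apply: s0; rewrite inE eqxx.
pose P a := `[< exists2 t, (enorm t <= S)%N & d * b = t * (a + rho * b) >].
have inS a : a \in s -> a \in b :: s by rewrite inE orbC => ->.
have far a : a \in s -> ~~ P a ->
    (8 * (1 + enorm rho) * enorm (a + rho * b)%R <= enorm b)%N.
  move=> sa /asboolPn nP; have [||t tE] := quo a b (inS a sa).
  - by rewrite inE eqxx.
  - by apply: contraNneq bs => <-.
  have tS : (S < enorm t)%N.
    by rewrite ltnNge; apply/negP => tS; apply: nP; exists t.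
  have := congr1 (@enorm R) tE; rewrite !enormM => eN.
  have dpos : (0 < enorm d)%N by rewrite enorm_gt0.
  rewrite -(leq_pmul2l dpos) eN mulnA [X in (X * _)%N]mulnC -/S.
  by rewrite leq_mul2r ltnW ?orbT.
have sz : size s = (size [seq x <- s | P x] + size [seq x <- s | ~~ P x])%N.
  by rewrite !size_filter count_predC.
have szP : (size [seq x <- s | P x] <= size l)%N.
  apply: (few b) => //; first exact: filter_uniq.
  by move=> a; rewrite mem_filter => /andP[/asboolP].
have szC : (size [seq x <- s | ~~ P x] <= 1 + size l)%N.
  case G: [seq x <- s | ~~ P x] => [//|a' g].
  have sg a : a \in a' :: g -> a \in s /\ ~~ P a.
    by rewrite -G mem_filter => /andP[].
  have : uniq [seq x <- s | ~~ P x] by exact: filter_uniq.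
  rewrite G => /andP[a'g ug].
  have [sa' Pa'] : a' \in s /\ ~~ P a' by apply: sg; rewrite inE eqxx.
  rewrite /= add1n ltnS; apply: (few a') => //; first exact/s0/inS.
  move=> a ga; have [sa Pa] : a \in s /\ ~~ P a.
    by apply: sg; rewrite inE ga orbT.
  have [||t tE] := quo a a' (inS a sa); first exact: inS.
    by apply: contraNneq a'g => <-.
  exists t => //.
  have fa := far a sa Pa; have fa' := far a' sa' Pa'.
  have n0 : (0 < enorm (a + rho * a')%R)%N.
    rewrite enorm_gt0.
    apply: contraTneq (mulf_neq0 d0 (s0 _ (inS _ sa'))) => a0.
    by rewrite negbK tE a0 mulr0.
  have bd : (enorm b <= enorm (d * b)%R)%N.
    by rewrite enormM leq_pmull // enorm_gt0.
  have dbE : d * b = ((a + rho * b) + rho * (a' + rho * b)) - (a + rho * a').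
    by rewrite dE; ring.
  have i1 := enormD_le ((a + rho * b) + rho * (a' + rho * b))
                       (- (a + rho * a')).
  have i2 := enormD_le (a + rho * b) (rho * (a' + rho * b)).
  have i3 := enormD_le (a' + rho * b) (- (rho * b)).
  rewrite -dbE enormN in i1; rewrite enormM in i2.
  rewrite addrK enormN enormM in i3.
  have := congr1 (@enorm R) tE; rewrite !enormM => eN.
  (* As d b is close to -(a + rho a'), the latter cannot be small. With a' close to -rho b this
     bounds the norm of a' in [k2], and then N(t) N(a + rho a') = N(d) N(a') gives N(t) <= S. *)
  have k1 : (enorm b <= 4 * enorm (a + rho * a')%R)%N.
    by apply: closeness_bound fa fa' _; clear -bd i1 i2; lia.
  have k2 : (enorm a' <= 8 * (1 + enorm rho) * enorm (a + rho * a')%R)%N.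
    have k3 : (enorm (a' + rho * b)%R <= enorm b)%N.
      by apply: leq_trans fa'; rewrite leq_pmull.
    have k4 := leq_mul (leqnn (2 * (1 + enorm rho))) k1.
    by clear -i3 k3 k4; lia.
  rewrite -(leq_pmul2r n0) -eN /S.
  rewrite [X in (_ <= X)%N]mulnAC [X in (_ <= X)%N]mulnC.
  by rewrite leq_mul2l k2 orbT.
rewrite /= sz; lia.
Qed.

End Thinning.

(** * Classes of prime divisors *)

Section PrimeClasses.
Variable R : realType.
Local Notation E := (eisenstein R).
Implicit Types (p x y rho : E) (A : {fset E}).

Lemma associates_refl x : associates x x.
Proof. by exists 1; rewrite ?unitr1 ?mul1r. Qed.

Lemma associates_divides p q n x : associates p q ->
  divides (p ^+ n) x <-> divides (q ^+ n) x.
Proof.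
move=> [u uU ->]; rewrite exprMn; split=> -[z ->].
  exists (z * (u ^+ n)^-1); rewrite -mulrA mulKr //; exact: unitrX.
by exists (z * u ^+ n); rewrite mulrA.
Qed.

Lemma omegaE_gt (r : R) x :
    (finite_set (prime_divisor_classes x) ->
     r < #|` fset_set (prime_divisor_classes x)|%:R) ->
  (r%:E < omegaE x)%E.
Proof.
rewrite /omegaE /counting; case: asboolP => [fin /(_ fin)|_ _].
  by rewrite lte_fin.
exact: ltry.
Qed.

Lemma prime_class_representatives x :
    finite_set (prime_divisor_classes x) ->
  exists ps, [/\ size ps = #|` fset_set (prime_divisor_classes x)|,
    {in ps, forall p, prime_elt p} &
    forall q, prime_elt q -> divides q x ->
      exists2 p, p \in ps & associates q p].
Proof.
move=> fin; set S := fset_set _.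
have /choice[g gP] : forall C : set E, exists p, C \in S ->
    prime_elt p /\ associates p = C.
  move=> C; have [|_] := boolP (C \in S); last by exists 0.
  by rewrite in_fset_set // inE => -[p [pp _] <-]; exists p.
have gC (C : set E) : C \in S -> C (g C).
  by move=> /gP[_ {1}<-]; exact: associates_refl.
exists [seq g C | C <- S]; split; first by rewrite size_map.
  by move=> _ /mapP[C CS ->]; case: (gP C CS).
move=> q qp qx; have CS : (associates q : set E) \in S.
  by rewrite in_fset_set // inE; exists q.
by exists (g (associates q)); [exact: map_f | exact: gC].
Qed.

(** Choose an Eisenstein prime above each rational prime of [s]. Associates above two different
    rational primes would divide both, hence 1 by Bezout. *)
Lemma size_rational_prime_divisors (s : seq nat) x :
    uniq s -> all prime s -> {in s, forall q, divides q%:R x} ->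
    finite_set (prime_divisor_classes x) ->
  (size s <= #|` fset_set (prime_divisor_classes x)|)%N.
Proof.
move=> us /allP ps sx fin.
have /choice[g gP] : forall q : nat, exists p : E, q \in s ->
    prime_elt p /\ divides p q%:R.
  move=> q; have [/ps pq|_] := boolP (q \in s); last by exists 0.
  have [||p pp pdvd] := @exists_prime_divisor R q%:R; last by exists p.
    by rewrite -enorm_eq0 enorm_nat expn_eq0 andbT -lt0n prime_gt0.
  by rewrite enorm_unit enorm_nat; have := prime_gt1 pq; case: q {pq} => [|[]].
rewrite -(size_map (fun q => associates (g q) : set E)).
apply: uniq_leq_size; last first.
  move=> _ /mapP[q qs ->]; have [pp pq] := gP q qs.
  rewrite in_fset_set // inE; exists (g q) => //; split=> //.
  exact: divides_trans (sx q qs).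
rewrite map_inj_in_uniq // => q1 q2 q1s q2s ass.
have [pp1 pq1] := gP _ q1s; have [pp2 pq2] := gP _ q2s.
apply/eqP; apply: contraT => q12.
have {}ass : associates (g q1) (g q2).
  by rewrite [associates (g q1)]ass; exact: associates_refl.
have g1q2 : divides (g q1) q2%:R.
  by have := associates_divides 1 q2%:R ass; rewrite !expr1 => ->.
have cop : coprime q1 q2.
  by rewrite prime_coprime ?ps // dvdn_prime2 ?ps.
case: (prime_elt_not_divides1 pp1).
have q1pos : (0 < q1)%N by rewrite prime_gt0 ?ps.
have [u v uv _] := egcdnP q2 q1pos.
rewrite (eqP cop) in uv.
have -> : 1 = u%:R * q1%:R - v%:R * q2%:R :> E.
  by rewrite -!natrM uv natrD addrC addKr.
by apply: dividesB; exact: divides_mull.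
Qed.

Definition pair_product rho A : E :=
  \prod_(a <- A) \prod_(b <- A | a != b) (a + rho * b).

Lemma divides_pair_product rho A a b : a \in A -> b \in A -> a != b ->
  divides (a + rho * b) (pair_product rho A).
Proof.
move=> aA bA ab.
apply: (@divides_trans _ _ (\prod_(c <- A | a != c) (a + rho * c))).
  exact: (divides_prod (fun c => a + rho * c) bA ab).
exact: (@divides_prod _ _ _ xpredT
  (fun c => \prod_(d <- A | c != d) (c + rho * d)) _ aA isT).
Qed.

(** Every rational prime divides 0. This shows that a pair product with finitely many prime classes
    is nonzero. *)
Lemma infinite_prime_classes0 : ~ finite_set (prime_divisor_classes (0 : E)).
Proof.
move=> fin; set k := #|` fset_set (prime_divisor_classes (0 : E))|.
have [s [us ps _ szs]] := @many_primes_below_pow2 (k + 8) (leq_addl _ _).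
have := size_rational_prime_divisors us ps (fun q _ => divides0 q%:R) fin.
rewrite -/k; lia.
Qed.

Lemma card_le_differences A (x := pair_product (-1) A) :
    finite_set (prime_divisor_classes x) ->
  (#|` A| <= 3 ^ #|` fset_set (prime_divisor_classes x)| * 4 ^ 9)%N.
Proof.
move=> fin; set k := #|` fset_set _|.
have [small|large] := leqP #|` A| (4 ^ 9).
  by apply: leq_trans small _; rewrite leq_pmull // expn_gt0.
have A1 : (0 < #|` A|.-1)%N.
  by rewrite -ltnS prednK; apply: leq_trans large => //; rewrite expn_gt0.
have A0 : #|` A|.-1.+1 = #|` A| by rewrite prednK //; exact: leq_trans large.
(* 4^t <= |A| - 1 gives q^2 < |A| for every q <= 2^t, the strict inequality required by the
   pigeonhole principle. *)
have /andP[tA At] := @trunc_log_bounds 4 _ isT A1.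
set t := trunc_log _ _ in tA At.
have t9 : (8 < t)%N.
  rewrite -ltnS -(@ltn_exp2l 4) //; apply: leq_ltn_trans At.
  by rewrite -ltnS A0.
have [s [us ps /allP ss szs]] := many_primes_below_pow2 (ltnW t9).
have sk : (size s <= k)%N.
  apply: size_rational_prime_divisors => // q qs.
  have [|||a [b [aA bA ab qab]]] := @eis_pigeonhole R q A.
  - by rewrite prime_gt0 // (allP ps).
  - exact: fset_uniq.
  - have /= qt := ss q qs.
    rewrite -A0 ltnS; apply: leq_trans tA.
    by rewrite -[4%N]/(2 ^ 2)%N -expnM mulnC expnM leq_exp2r.
  apply: divides_trans qab _; rewrite -mulN1r.
  exact: divides_pair_product.
have tk : (t.*2 <= k)%N by apply: leq_trans sk.
(* |A| <= 4^(t+1), with 4^t <= 9^t = 3^(2t) <= 3^k. *)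
rewrite -A0; apply: leq_trans At _; rewrite expnS mulnC; apply: leq_mul.
  apply: leq_trans (_ : 9 ^ t <= _)%N; first by rewrite leq_exp2r //; lia.
  by rewrite -[9%N]/(3 ^ 2)%N -expnM mul2n leq_exp2l.
by rewrite -[X in (X <= _)%N]expn1 leq_exp2l.
Qed.

Lemma card_le_generic rho : rho != 0 -> 1 + rho != 0 ->
  exists B : nat, forall A (x := pair_product rho A),
    finite_set (prime_divisor_classes x) ->
  (#|` A| <= 3 ^ #|` fset_set (prime_divisor_classes x)| * B.+1)%N.
Proof.
move=> rho0 rho1; have [B BP] := mutual_divisor_bound rho0 rho1.
exists B => A x fin; set k := #|` fset_set _|.
have x0 : x != 0.
  by apply/eqP => x0; apply: infinite_prime_classes0; rewrite -x0.
have [ps [szps psP reps]] := prime_class_representatives fin.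
(* Thinning needs nonzero elements; dropping 0 costs at most one element, paid for by the successor
   in [B.+1]. *)
pose s := [seq a <- A | a != 0].
have s0 : {in s, forall a, a != 0} by move=> a; rewrite mem_filter => /andP[].
have [s' [s's szs s'P]] := thin_primes rho0 rho1 psP s0.
have sA a : a \in s' -> a \in A.
  by move/(mem_subseq s's); rewrite mem_filter => /andP[].
have szA : (#|` A| <= (size s).+1)%N.
  rewrite -(count_predC (pred1 0) A) count_uniq_mem ?fset_uniq //.
  by rewrite size_filter -add1n leq_add2r; case: (_ \in _).
have s'B : (size s' <= B)%N.
  apply: BP.
  - by apply: subseq_uniq s's _; rewrite filter_uniq // fset_uniq.
  - by move=> a /(mem_subseq s's) /s0.
  move=> a b sa sb ab.
  have abx := divides_pair_product rho (sA a sa) (sA b sb) ab.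
  have ab0 : a + rho * b != 0.
    by apply: contraNneq x0 => ab0; case: abx => z; rewrite ab0 mulr0 => /eqP.
  have a0 : a != 0 by exact/s0/(mem_subseq s's).
  have ha0 : (1 + rho) * a != 0 by rewrite mulf_neq0.
  (* A prime dividing a + rho b divides the whole product, so it is an associate of a representative
     p, for which thinning bounds the exponent. *)
  apply: divides_local => // q qp qab n.
  have [p pps qps] := reps q qp (divides_trans qab abx).
  rewrite !(associates_divides n _ qps) => pn.
  apply/(vpP (psP p pps) ha0); rewrite leqNgt; apply/negP => lt_n.
  apply: (s'P p pps a b sa sb); apply: divides_trans pn.
  exact: divides_exp.
rewrite szps -/k in szs; apply: leq_trans szA _.
rewrite mulnS addnC -addn1; apply: leq_add; last by rewrite expn_gt0.
by apply: leq_trans szs _; rewrite leq_mul2l s'B orbT.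
Qed.

End PrimeClasses.

(** * Passage to logarithms and conclusion *)

Lemma ln_card_lt (R : realType) (n k B : nat) : (n <= 3 ^ k * B.+1)%N ->
  ln (n%:R : R) / ln 3 - (ln (B.+1%:R) / ln 3 + 1) < k%:R.
Proof.
move=> nkB; have ln3 : 0 < ln (3 : R) by rewrite ln_gt0 // ltr1n.
have lnB : 0 <= ln (B.+1%:R : R) by rewrite ln_ge0 // ler1n.
suff : ln (n%:R : R) <= k%:R * ln 3 + ln B.+1%:R.
  move=> h; rewrite opprD addrA -mulrBl ltrBlDr.
  (* The 1 added to the constant makes the inequality strict. *)
  apply: le_lt_trans (_ : k%:R < _); last by rewrite ltrDl.
  by rewrite ler_pdivrMr // lerBlDr.
case: n nkB => [|n] nkB.
  (* For the empty set, [ln] takes the default value 0 at 0. *)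
  by rewrite ln0 // addr_ge0 // mulr_ge0 // ltW.
rewrite mulr_natl -lnXn // -lnM ?posrE ?exprn_gt0 //.
by rewrite ler_ln ?posrE ?mulr_gt0 ?exprn_gt0 // -natrX -natrM ler_nat.
Qed.

(** The case rho = 0 has to be excluded: if A consists of powers of a single prime, the product then
    has only one prime class, however large A is. *)
Theorem theorem2 (R : realType) (rho : eisenstein R) (rho_neq0 : rho != 0) :
  exists c : R, forall A : {fset eisenstein R},
    ((ln (#|` A|%:R) / ln 3 - c)%:E
       < omegaE (\prod_(a <- A) \prod_(b <- A | a != b) (a + rho * b))%R)%E.
Proof.
suff [B BP] : exists B : nat, forall A : {fset eisenstein R},
    finite_set (prime_divisor_classes (pair_product rho A)) ->
    (#|` A| <= 3 ^ #|` fset_set (prime_divisor_classes (pair_product rho A))|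
               * B.+1)%N.
  exists (ln (B.+1%:R) / ln 3 + 1) => A.
  by apply: omegaE_gt => fin; apply/ln_card_lt/BP.
have [rho1|] := eqVneq (1 + rho) 0; last exact: card_le_generic.
exists (4 ^ 9).-1 => A; rewrite prednK ?expn_gt0 //.
have -> : rho = -1 by apply/eqP; rewrite -addr_eq0 addrC rho1.
exact: card_le_differences.
Qed.
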